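(* Let $N$ be a positive integer, let $d_2$ be the Euclidean distance on $\mathcal{L}_N=\{0,1,\dots,N-1\}^2$, and let $G_L$ be the directed graph on $\mathcal{L}_N$ induced by $V_L$ (see context). Then for every integer $L$ with $1\le L<N-1$ $$1-\frac{\sqrt{1+4L^2}}{L+\sqrt{1+L^2}}\le\Gamma_{G_L,d_2}\le c(L)\left(1-\frac{L}{\sqrt{1+L^2}}\right),$$ for some $c(L)$ depending only on $L$, where $0.25<c(L)<0.26$ and $c(L)$ is monotone decreasing in $L$. Asymptotically, $$\Gamma_{G_L,d_2}=\frac{1}{8L^2}-\frac{11}{128L^4}+O\left(\frac1{L^6}\right)\qquad\text{for }L\to+\infty.$$
   Context: Let $V_0=\{(1,0),(0,1),(-1,0),(0,-1)\}$ and, for an integer $L\ge1$, $$V_L=V_0\cup\{(i_1,i_2)\in(\mathbb{Z}\setminus\{0\})^2:\ |i_1|\le L,\ |i_2|\le L,\ |i_1|\text{ and }|i_2|\text{ coprime}\}.$$ The graph induced by $V_L$ is $G_L=(\mathcal{L}_N,E_L)$ with $E_L=\{(\mathbf i,\mathbf i+\mathbf j):\ \mathbf i\in\mathcal{L}_N,\ \mathbf j\in V_L,\ \mathbf i+\mathbf j\in\mathcal{L}_N\}$ (directed edges). The distance is $d_2(\mathbf i,\mathbf j)=\sqrt{|i_1-j_1|^2+|i_2-j_2|^2}$. For a directed graph $G$ with vertex set $X$ and a distance $d$ on $X$, $d_G(x,y)$ denotes the minimum, over all directed paths in $G$ from $x$ to $y$, of the sum of the costs $d$ of the edges of the path, and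 $\Gamma_{G,d}=\max\{1-d(x,y)/d_G(x,y):\ x,y\in X,\ x\neq y\}$.
   Formalization: The lower bound and the asymptotic expansion are stated for 2L ≤ N−1 (uniformly in N) instead of all L < N−1, since they fail otherwise: for N=4, L=2, Γ = 1−√10/(1+√5) ≈ 0.0228, below the claimed 0.0267. *)

(* Defs.v *)
From mathcomp Require Import all_boot all_order all_algebra.
From mathcomp Require Import boolp classical_sets reals.

Set Implicit Arguments.
Unset Strict Implicit.
Unset Printing Implicit Defensive.

Import Order.TTheory GRing.Theory Num.Theory.

Local Open Scope ring_scope.
Local Open Scope classical_set_scope.

Section DirectedGraph.
Variables (R : realType) (X : finType) (e : rel X) (d : X -> X -> R).
Implicit Types (x y : X) (p : seq X).

(* The directed path is x :: p, as in [path]. *)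
Fixpoint path_cost x p : R :=
  if p is y :: p' then d x y + path_cost y p' else 0.

Definition path_costs x y : set R :=
  [set r | exists p, [/\ path e x p, last x p = y & r = path_cost x p]].

(* For nonnegative costs the infimum is a minimum as soon as y is reachable
   from x: see [graph_dist_min]. *)
Definition graph_dist x y : R := inf (path_costs x y).

Definition Gamma_values : set R :=
  [set r | exists x y, x <> y /\ r = 1 - d x y / graph_dist x y].

(* X being finite, the supremum is a maximum as soon as X has two distinct
   points: see [Gamma_max]. *)
Definition Gamma : R := sup Gamma_values.

Lemma path_cost_cat x p q :
  path_cost x (p ++ q) = path_cost x p + path_cost (last x p) q.
Proof.
by elim: p x => [|y p IH] x /=; rewrite ?add0r // IH addrA.
Qed.

Lemma path_cost_ge0 x p : (forall u v, 0 <= d u v) -> 0 <= path_cost x p.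
Proof. by move=> d0; elim: p x => //= y p IH x; rewrite addr_ge0. Qed.

Lemma path_cost_shorten x p : (forall u v, 0 <= d u v) -> path e x p ->
  exists q, [/\ path e x q, last x q = last x p, uniq (x :: q) &
                path_cost x q <= path_cost x p].
Proof.
move=> d0; elim: p x => [|y p IH] x /=; first by exists [::].
case/andP=> exy /IH[q [eq lq uq cq]].
have ec : path e x (y :: q) by rewrite /= exy.
have cc : path_cost x (y :: q) <= d x y + path_cost y p by rewrite lerD2l.
rewrite -lq -[last y q]/(last x (y :: q)).
have [xq|xNq] := boolP (x \in y :: q); last first.
  by exists (y :: q); rewrite cons_uniq xNq.
case/splitPr: xq ec cc uq => s1 s2; rewrite cat_path => /and3P[_ _ e2] cc.
rewrite cat_uniq => /and3P[_ _ u2]; exists s2; split=> //.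
  by rewrite last_cat.
apply: le_trans cc; rewrite path_cost_cat /= addrA lerDr.
by rewrite addr_ge0 ?path_cost_ge0.
Qed.

Lemma graph_dist_le x p : (forall u v, 0 <= d u v) -> path e x p ->
  graph_dist x (last x p) <= path_cost x p.
Proof.
move=> d0 ep; apply: ge_inf; last by exists p.
by exists 0 => _ [q [_ _ ->]]; exact: path_cost_ge0.
Qed.

Lemma graph_dist_min x y : (forall u v, 0 <= d u v) ->
  (exists2 p, path e x p & last x p = y) ->
  exists p, [/\ path e x p, last x p = y & graph_dist x y = path_cost x p].
Proof.
move=> d0 [p0 ep0 lp0].
pose P (b : {bseq #|X| of X}) := path e x b && (last x b == y).
have bP p : path e x p -> last x p = y ->
    exists2 b, P b & path_cost x b <= path_cost x p.
  move=> /(path_cost_shorten d0)[q [eq lq uq cq]] lp.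
  have sq : (size q <= #|X|)%N.
    by apply: ltnW; rewrite -[(size q).+1]/(size (x :: q)) -(card_uniqP uq) max_card.
  by exists (Bseq sq) => //=; rewrite /P /= eq lq lp eqxx.
have [b0 Pb0 _] := bP _ ep0 lp0.
have [b /andP[eb /eqP lb] bmin] := arg_minP (fun b : {bseq #|X| of X} => path_cost x b) Pb0.
exists b; split=> //; apply/eqP; rewrite eq_le -{1}lb graph_dist_le //=.
apply: lb_le_inf; first by exists (path_cost x b), b.
by move=> _ [p [ep lp ->]]; have [b' /bmin le1 /(le_trans le1)] := bP _ ep lp.
Qed.

Lemma Gamma_max : (1 < #|X|)%N ->
  (exists x y, x <> y /\ Gamma = 1 - d x y / graph_dist x y) /\
  (forall x y, x <> y -> 1 - d x y / graph_dist x y <= Gamma).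
Proof.
move=> /card_gt1P[x0 [y0 [_ _ /= xy0]]].
pose F (z : X * X) := 1 - d z.1 z.2 / graph_dist z.1 z.2.
pose P (z : X * X) := z.1 != z.2.
have P0 : P (x0, y0) by [].
have [[x y] /eqP /= xy mx] := arg_maxP F P0.
have ub : ubound Gamma_values (F (x, y)).
  by move=> _ [u [v [/eqP uv ->]]]; exact: (mx (u, v)).
have Fxy : Gamma_values (F (x, y)) by exists x, y.
have GE : Gamma = F (x, y).
  apply/eqP; rewrite eq_le ge_sup //=; last by exists (F (x, y)).
  by apply: ub_le_sup => //; exists (F (x, y)).
split; first by exists x, y.
by move=> u v uv; rewrite GE; apply: ub; exists u, v.
Qed.

End DirectedGraph.

Definition lattice N : finType := ('I_N * 'I_N)%type.

Definition V0 : seq (int * int) := [:: (1, 0); (0, 1); (-1, 0); (0, -1)].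

Definition VL (L : nat) : pred (int * int) := fun j =>
  (j \in V0) ||
  [&& j.1 != 0, j.2 != 0, (`|j.1| <= L)%N, (`|j.2| <= L)%N
    & coprime `|j.1| `|j.2|].

(* The edge (i, i + j) is encoded by its endpoints i and k = i + j. *)
Definition EL N L : rel (lattice N) := fun i k =>
  VL L ((k.1 : nat)%:Z - (i.1 : nat)%:Z, (k.2 : nat)%:Z - (i.2 : nat)%:Z).

Definition d2 (R : realType) N (i j : lattice N) : R :=
  Num.sqrt (`|i.1%:R - j.1%:R| ^+ 2 + `|i.2%:R - j.2%:R| ^+ 2).

Definition GammaGL (R : realType) (N L : nat) : R := Gamma (@EL N L) (@d2 R N).

(* In G_L every vertex is reachable from every other one, so by
   [graph_dist_min] all the distances in [GammaGL] are minima. *)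
Lemma GL_connected N L (x y : lattice N) :
  exists2 p, path (@EL N L) x p & last x p = y.
Proof.
suff conn0 (z o : lattice N) : val o.1 = 0%N -> val o.2 = 0%N ->
    connect (@EL N L) z o && connect (@EL N L) o z.
  have N0 : (0 < N)%N by apply: leq_ltn_trans (leq0n _) (ltn_ord x.1).
  pose o : lattice N := (Ordinal N0, Ordinal N0).
  have /andP[xo _] := conn0 x o erefl erefl.
  have /andP[_ oy] := conn0 y o erefl erefl.
  by have /connectP[p ep ->] := connect_trans xo oy; exists p.
move=> o1 o2; have [n] := ubnP (z.1 + z.2)%N.
elim: n z => // n IH [i j]; rewrite ltnS /= => ijn.
have step (k l : lattice N) : (k.1 + k.2 < n)%N -> EL L l k -> EL L k l ->
    connect (@EL N L) l o && connect (@EL N L) o l.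
  move=> /IH/andP[ko ok] lk kl; apply/andP; split.
    exact: connect_trans (connect1 lk) ko.
  exact: connect_trans ok (connect1 kl).
have stepZ m : (m%:Z - m.+1%:Z = -1) * (m.+1%:Z - m%:Z = 1).
  by rewrite -addn1 PoszD opprD addrA subrr add0r addrAC subrr add0r.
case: i ijn => -[|i] hi /=; last first.
  move=> ijn; apply: (step (Ordinal (ltnW hi), j)) => //=.
    by rewrite /EL /VL /= stepZ subrr.
  by rewrite /EL /VL /= stepZ subrr.
case: j => -[|j] hj /= ijn; last first.
  apply: (step (Ordinal hi, Ordinal (ltnW hj))) => //=.
    by rewrite /EL /VL /= stepZ subrr.
  by rewrite /EL /VL /= stepZ subrr.
rewrite (_ : o = (Ordinal hi, Ordinal hj)) ?connect0 //.
by case: o {IH step} o1 o2 => u v /= u0 v0; congr (_, _); apply/val_inj.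
Qed.

(* Main.v *)
Require Import Defs.
From mathcomp Require Import all_boot all_order all_algebra.
From mathcomp Require Import boolp classical_sets reals.
From mathcomp Require Import zify ring lra.

Set Implicit Arguments.
Unset Strict Implicit.
Unset Printing Implicit Defensive.

Import Order.TTheory GRing.Theory Num.Theory.

Local Open Scope ring_scope.

(** Let theta be the angle between (L, 1) and (1, 0), so that its cotangent
    is L and [coshalf L] is cos (theta / 2).

    Upper bound.  As for the Farey sequence, inserting mediants until they
    leave the box cuts the first quadrant into cones, each spanned by two
    directions u, w of V_L with determinant 1 whose mediant u + w is no longer
    in V_L ([cone_decomposition]).  That u + w is too large forces u . w >= L,
    and since the determinant is 1 this scalar product is the cotangent of the
    angle between u and w, which is therefore at most theta.  A displacement
    in the quadrant is m u + n w with m, n naturals; when it is a multiple of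
    u or of w alone, walking straight costs exactly its length, and no bound
    on the angle is called for.  Walking m times along u and then n times
    along w stays in the grid, both coordinates being monotone.  For two
    vectors p and q at an angle at most theta,
    |p + q| >= cos (theta / 2) (|p| + |q|); hence Gamma <= 1 - cos (theta / 2) ([Gamma_le]).  Finally
    1 - cos (theta / 2) = c(L) (1 - cos theta)
    with c(L) = 1 / (2 (1 + cos (theta / 2))), which explains at once the
    limit value 1/4 and the monotonicity of c.

    Lower bound.  From (0, 0) to (2 L, 1) one can do no better than L + 1 steps
    of total length L + sqrt (1 + L^2).  Optimality is certified by duality:
    the linear form x + (sqrt (1 + L^2) - L) y takes the value 1 at (1, 0)
    and the value sqrt (1 + L^2) at (L, 1), and it is bounded by the
    Euclidean norm at every step of V_L ([linear_form_le_step]), so its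
    increment bounds the cost of every path ([Gamma_ge]).

    Asymptotics.  In terms of e = 1 / L^2 both bounds have the expansion
    e / 8 - 11 e^2 / 128 + O(e^3), here with explicit constant 1 in the
    directions that matter ([lower_bound_expansion], [coshalf_expansion]). *)

(** * Graph distances: potentials and positivity *)

(** Weak duality for shortest paths: the increments of the potential
    telescope along the path. *)
Lemma path_cost_ge_potential (R : realType) (X : finType) (e : rel X)
    (d : X -> X -> R) (phi : X -> R) x p :
  (forall u v, e u v -> phi v - phi u <= d u v) ->
  path e x p -> phi (last x p) - phi x <= path_cost d x p.
Proof.
move=> phid; elim: p x => [|y p IH] x /=; first by rewrite subrr.
case/andP=> /phid exy /IH; lra.
Qed.

Lemma path_cost_eq0 (R : realType) (X : finType) (d : X -> X -> R) x p :
  (forall u v, 0 <= d u v) -> (forall u v, d u v = 0 -> u = v) ->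
  path_cost d x p = 0 -> last x p = x.
Proof.
move=> d0 dE; elim: p x => [|y p IH] x //= /eqP.
rewrite paddr_eq0 ?path_cost_ge0// => /andP[/eqP/dE-> /eqP].
exact: IH.
Qed.

(** In [1 - d x y / graph_dist x y] the division by a zero distance would give
    the value 1, so positivity has to be known before bounding [Gamma]. *)
Lemma graph_dist_gt0 (R : realType) (X : finType) (e : rel X)
    (d : X -> X -> R) x y :
  (forall u v, 0 <= d u v) -> (forall u v, d u v = 0 -> u = v) ->
  (exists2 p, path e x p & last x p = y) -> x <> y -> 0 < graph_dist e d x y.
Proof.
move=> d0 dE /(graph_dist_min d0)[p [_ lp ->]] xy.
rewrite lt_neqAle path_cost_ge0// andbT eq_sym.
by apply/eqP => /(path_cost_eq0 d0 dE); rewrite lp => /esym.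
Qed.

(** * Farey cones *)

(** A common divisor of the entries of a row divides the determinant. *)
Lemma det1_coprime a b c d : (a * d = b * c + 1)%N -> coprime a b /\ coprime c d.
Proof.
move=> det; split; rewrite /coprime -dvdn1.
  rewrite -(dvdn_addr 1 (m := b * c)) ?dvdn_mulr ?dvdn_gcdr//.
  by rewrite -det dvdn_mulr ?dvdn_gcdl.
rewrite -(dvdn_addr 1 (m := b * c)) ?dvdn_mull ?dvdn_gcdl//.
by rewrite -det dvdn_mull ?dvdn_gcdr.
Qed.

(** The subtractive Euclidean algorithm on the coordinates (m, n): if the
    mediant is still in the box, the vector lies in one of the two cones that
    the mediant cuts off, with coordinates (m, n - m) or (m - n, n).  If the
    mediant has left the box, then say a + c > L, where a, c >= 1 because
    neither exceeds L alone; then (a - 1) (c - 1) >= 0 yields a c >= L. *)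
Lemma cone_refine (L a b c d m n : nat) :
  (a * d = b * c + 1)%N -> (a <= L)%N -> (b <= L)%N -> (c <= L)%N ->
  (d <= L)%N ->
  exists a' b' c' d' m' n' : nat,
    [/\ (a' * d' = b' * c' + 1)%N,
        [&& a' <= L, b' <= L, c' <= L & d' <= L]%N,
        (m * a + n * c = m' * a' + n' * c')%N,
        (m * b + n * d = m' * b' + n' * d')%N
      & (m' * n' = 0)%N \/ (L <= a' * c' + b' * d')%N].
Proof.
have [k] := ubnP (m + n)%N.
elim: k a b c d m n => // k IH a b c d m n mnk det aL bL cL dL.
have [mn0|mn0] := eqVneq (m * n)%N 0%N.
  by exists a, b, c, d, m, n; split=> //; [rewrite aL bL cL | left].
have [/andP[acL bdL]|maxL] := boolP ((a + c <= L) && (b + d <= L))%N.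
  have [mn|nm] := leqP m n.
    case: (IH (a + c)%N (b + d)%N c d m (n - m)%N); try nia.
    move=> a' [b' [c' [d' [m' [n' [? ? eA eB ?]]]]]].
    exists a', b', c', d', m', n'; split=> //; nia.
  case: (IH a b (a + c)%N (b + d)%N (m - n)%N n); try nia.
  move=> a' [b' [c' [d' [m' [n' [? ? eA eB ?]]]]]].
  exists a', b', c', d', m', n'; split=> //; nia.
exists a, b, c, d, m, n; split=> //; first by rewrite aL bL cL.
right; rewrite negb_and -!ltnNge in maxL.
have a0 : (0 < a)%N by nia.
have d0 : (0 < d)%N by nia.
case/orP: maxL => maxL.
  have c0 : (0 < c)%N by lia.
  have : (a + c <= a * c + 1)%N by nia.
  lia.
have b0 : (0 < b)%N by lia.
have : (b + d <= b * d + 1)%N by nia.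
lia.
Qed.

(** The refinement starts from the whole quadrant. *)
Lemma cone_decomposition (L A B : nat) : (1 <= L)%N ->
  exists a b c d m n : nat,
    [/\ (a * d = b * c + 1)%N,
        [&& a <= L, b <= L, c <= L & d <= L]%N,
        A = (m * a + n * c)%N, B = (m * b + n * d)%N
      & (m * n = 0)%N \/ (L <= a * c + b * d)%N].
Proof.
move=> L1; case: (@cone_refine L 1 0 0 1 A B) => //.
move=> a [b [c [d [m [n [? ? eA eB ?]]]]]].
exists a, b, c, d, m, n; split=> //; lia.
Qed.

(** * Half angles and expansions *)

Section Analysis.
Variable R : realType.
Implicit Types l t e : R.

(** The cosine of the angle in (0, pi) whose cotangent is [t]. *)
Definition coscot t : R := t / Num.sqrt (1 + t ^+ 2).

(** The cosine of half that angle, by the half-angle formula. *)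
Definition coshalf t : R := Num.sqrt ((1 + coscot t) / 2).

Lemma sqrt1D_gt0 t : 0 < Num.sqrt (1 + t ^+ 2).
Proof. by rewrite sqrtr_gt0 ltr_pwDl ?sqr_ge0. Qed.

Lemma sqr_sqrt1D t : Num.sqrt (1 + t ^+ 2) ^+ 2 = 1 + t ^+ 2.
Proof. by rewrite sqr_sqrtr// addr_ge0 ?sqr_ge0. Qed.

Lemma coscot_ge0 t : 0 <= t -> 0 <= coscot t.
Proof. by move=> t0; rewrite divr_ge0 ?sqrtr_ge0. Qed.

Lemma coscot_lt1 t : coscot t < 1.
Proof.
rewrite ltr_pdivrMr ?sqrt1D_gt0// mul1r.
rewrite (le_lt_trans (ler_norm t))// -sqrtr_sqr ltr_sqrt; last first.
  by rewrite ltr_pwDl ?sqr_ge0.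
by rewrite ltrDr.
Qed.

Lemma coscot_lt l t : 0 <= l -> l < t -> coscot l < coscot t.
Proof.
move=> l0 lt; have t0 : 0 < t by lra.
rewrite ltr_pdivrMr ?sqrt1D_gt0// mulrAC ltr_pdivlMr ?sqrt1D_gt0//.
have t0' := ltW t0.
rewrite -ltr_sqr; [|by rewrite nnegrE mulr_ge0 ?sqrtr_ge0..].
rewrite !exprMn !sqr_sqrt1D.
have : 0 < (t - l) * (t + l) by rewrite mulr_gt0//; lra.
lra.
Qed.

Lemma coscot_le l t : 0 <= l -> l <= t -> coscot l <= coscot t.
Proof.
by move=> l0; rewrite le_eqVlt => /predU1P[->//|lt]; rewrite ltW ?coscot_lt.
Qed.

Lemma coshalf_sqr t : 0 <= t -> coshalf t ^+ 2 = (1 + coscot t) / 2.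
Proof. by move=> /coscot_ge0 k; rewrite sqr_sqrtr//; lra. Qed.

Lemma coshalf_lt l t : 0 <= l -> l < t -> coshalf l < coshalf t.
Proof.
move=> l0 lt; have k := coscot_lt l0 lt; have k0 := coscot_ge0 l0.
by rewrite ltr_sqrt; lra.
Qed.

Lemma coshalf_lt1 t : 0 <= t -> coshalf t < 1.
Proof.
move=> t0; rewrite -ltr_sqr ?nnegrE ?sqrtr_ge0// coshalf_sqr// expr1n.
by have := coscot_lt1 t; lra.
Qed.

(** The constant is the one for which 1 / (2 (1 + 12 / 13)) = 26 / 100.  The
    true value at t = 1 is cos (pi / 8), about 0.9239, against 0.9231. *)
Lemma coshalf_gt t : 1 <= t -> 12 / 13 < coshalf t.
Proof.
move=> t1; have t0 : 0 <= t by lra.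
rewrite -ltr_sqr ?nnegrE ?sqrtr_ge0//; last by lra.
rewrite coshalf_sqr//.
(* Any number between 2 (12 / 13)^2 - 1 = 119 / 169 and 1 / sqrt 2 would do. *)
suff : 141 / 200 < coscot t by lra.
apply: lt_le_trans (coscot_le ler01 t1).
rewrite ltr_pdivlMr ?sqrt1D_gt0//.
rewrite -ltr_sqr ?nnegrE// ?mulr_ge0 ?sqrtr_ge0//; last by lra.
by rewrite exprMn sqr_sqrt1D; lra.
Qed.

(** With p = m U and q = n W, where U and W are the two norms, and with t the
    scalar product and k = [coscot l], the difference of the squares of the
    two sides is (1 - k) / 2 (p - q)^2 + 2 m n (t - k U W).  The
    determinant being 1, Lagrange's identity gives U W = sqrt (1 + t^2), so
    that t = [coscot t] U W >= k U W. *)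
Lemma cone_ratio l a b c d m n :
  0 <= l -> 0 <= a * c + b * d -> 0 <= m -> 0 <= n ->
  a * d = b * c + 1 -> m * n = 0 \/ l <= a * c + b * d ->
  coshalf l * (m * Num.sqrt (a ^+ 2 + b ^+ 2) + n * Num.sqrt (c ^+ 2 + d ^+ 2))
  <= Num.sqrt ((m * a + n * c) ^+ 2 + (m * b + n * d) ^+ 2).
Proof.
move=> l0 t0 m0 n0 det lt.
set U := Num.sqrt (a ^+ 2 + b ^+ 2); set W := Num.sqrt (c ^+ 2 + d ^+ 2).
have U0 : 0 <= U := sqrtr_ge0 _; have W0 : 0 <= W := sqrtr_ge0 _.
have UE : U ^+ 2 = a ^+ 2 + b ^+ 2 by rewrite sqr_sqrtr// addr_ge0 ?sqr_ge0.
have WE : W ^+ 2 = c ^+ 2 + d ^+ 2 by rewrite sqr_sqrtr// addr_ge0 ?sqr_ge0.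
have S0 : 0 <= (m * a + n * c) ^+ 2 + (m * b + n * d) ^+ 2.
  by rewrite addr_ge0 ?sqr_ge0.
rewrite -ler_sqr ?nnegrE ?sqrtr_ge0 ?mulr_ge0 ?addr_ge0 ?sqrtr_ge0 ?mulr_ge0//.
rewrite exprMn coshalf_sqr// sqr_sqrtr//.
set t := a * c + b * d in t0 lt.
have UW : U * W = Num.sqrt (1 + t ^+ 2).
  rewrite -[LHS]ger0_norm ?mulr_ge0// -sqrtr_sqr exprMn UE WE.
  congr Num.sqrt; apply/eqP; rewrite -subr_eq0; apply/eqP.
  have -> : (1 : R) = (a * d - b * c) ^+ 2 by rewrite det; ring.
  by rewrite /t; ring.
have key : 0 <= m * n * (t - coscot l * (U * W)).
  case: lt => [->|lt]; first by rewrite mul0r.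
  apply: mulr_ge0; first exact: mulr_ge0.
  rewrite subr_ge0 UW -ler_pdivlMr ?sqrt1D_gt0//.
  exact: coscot_le.
have sq : 0 <= (1 - coscot l) / 2 * (m * U - n * W) ^+ 2.
  by rewrite mulr_ge0 ?sqr_ge0//; have := coscot_lt1 l; lra.
rewrite -subr_ge0.
have -> : (m * a + n * c) ^+ 2 + (m * b + n * d) ^+ 2
    - (1 + coscot l) / 2 * (m * U + n * W) ^+ 2
  = 2 * (m * n * (t - coscot l * (U * W)))
    + (1 - coscot l) / 2 * (m * U - n * W) ^+ 2.
  have -> : (m * a + n * c) ^+ 2 + (m * b + n * d) ^+ 2
     = m ^+ 2 * U ^+ 2 + n ^+ 2 * W ^+ 2 + 2 * m * n * t.
    by rewrite UE WE /t; ring.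
  by field.
lra.
Qed.

(** The two sides agree at (1, 0) and at (l, 1).  With s = sqrt (1 + l^2) - l,
    which satisfies 2 s l = 1 - s^2, squaring reduces the claim for y > 0 to
    2 s x <= y (1 - s^2).  Integrality of the second coordinate enters through
    the gap between 0 and 1. *)
Lemma linear_form_le_norm l x y : 0 <= l -> x <= l -> y <= 0 \/ 1 <= y ->
  x + (Num.sqrt (1 + l ^+ 2) - l) * y <= Num.sqrt (x ^+ 2 + y ^+ 2).
Proof.
move=> l0 xl y01; set s := _ - l.
have ls : s + l = Num.sqrt (1 + l ^+ 2) by rewrite /s; ring.
have s0 : 0 < s.
  rewrite subr_gt0 -[X in X < _](ger0_norm l0) -sqrtr_sqr ltr_sqrt ?ltrDr//.
  by rewrite ltr_pwDl ?sqr_ge0.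
have sE : 2 * s * l = 1 - s ^+ 2 by have := sqr_sqrt1D l; rewrite -ls; lra.
have [xs|xs] := leP (x + s * y) 0; first exact: le_trans xs (sqrtr_ge0 _).
case: y01 => [y0|y1].
  apply: (@le_trans _ _ x); first by rewrite gerDl pmulr_rle0.
  rewrite (le_trans (ler_norm x))// -sqrtr_sqr ler_wsqrtr// lerDl sqr_ge0//.
rewrite -ler_sqr ?nnegrE ?sqrtr_ge0 ?(ltW xs)// sqr_sqrtr ?addr_ge0 ?sqr_ge0//.
have k1 : 0 <= 2 * s * y * (l - x) by rewrite !mulr_ge0//; lra.
have k2 : 0 <= y * (y - 1) * (1 - s ^+ 2).
  by rewrite -sE !mulr_ge0//; lra.
have k3 : 2 * s * l * y = (1 - s ^+ 2) * y by rewrite sE.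
rewrite -subr_ge0.
have -> : x ^+ 2 + y ^+ 2 - (x + s * y) ^+ 2
  = 2 * s * y * (l - x) + y * (y - 1) * (1 - s ^+ 2)
    + ((1 - s ^+ 2) * y - 2 * s * l * y) by ring.
by rewrite k3 subrr addr0 addr_ge0.
Qed.

Lemma sqrt1D_le e : 0 <= e -> e <= 1 ->
  Num.sqrt (1 + e) <= 1 + e / 2 - e ^+ 2 / 8 + e ^+ 3 / 16.
Proof.
move=> e0 e1; set P := leRHS.
have e21 : e ^+ 2 <= e by rewrite expr2 ler_piMl.
have p2 : 0 <= e ^+ 2 by rewrite exprn_ge0.
have p3 : 0 <= e ^+ 3 by rewrite exprn_ge0.
have p4 : 0 <= e ^+ 4 by rewrite exprn_ge0.
have p6 : 0 <= e ^+ 6 by rewrite exprn_ge0.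
have e54 : e ^+ 5 <= e ^+ 4 by rewrite exprS ler_piMl.
have P0 : 0 <= P by rewrite /P; lra.
rewrite -(ger0_norm P0) -sqrtr_sqr ler_wsqrtr// -subr_ge0.
have -> : P ^+ 2 - (1 + e) = e ^+ 4 * 5 / 64 - e ^+ 5 / 64 + e ^+ 6 / 256.
  by rewrite /P; field.
lra.
Qed.

Lemma sqrt1D_ge e : 0 <= e -> e <= 1 ->
  1 + e / 2 - e ^+ 2 / 8 <= Num.sqrt (1 + e).
Proof.
move=> e0 e1; set Q := leLHS.
have e21 : e ^+ 2 <= e by rewrite expr2 ler_piMl.
have p3 : 0 <= e ^+ 3 by rewrite exprn_ge0.
have e43 : e ^+ 4 <= e ^+ 3 by rewrite exprS ler_piMl.
have Q0 : 0 <= Q by rewrite /Q; lra.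
rewrite -(ger0_norm Q0) -sqrtr_sqr ler_wsqrtr// -subr_ge0.
have -> : 1 + e - Q ^+ 2 = e ^+ 3 / 8 - e ^+ 4 / 64 by rewrite /Q; field.
lra.
Qed.

(** Rescaling to the small parameter e = 1 / l^2. *)
Lemma sqrt1D_scale l e : 0 < l -> e * l ^+ 2 = 1 ->
  Num.sqrt (1 + l ^+ 2) = l * Num.sqrt (1 + e).
Proof.
move=> l0 el; have -> : 1 + l ^+ 2 = l ^+ 2 * (1 + e).
  by rewrite mulrDr mulr1 [_ * e]mulrC el addrC.
by rewrite sqrtrM ?sqr_ge0// sqrtr_sqr gtr0_norm.
Qed.

(** Every square root is replaced by its Taylor polynomial, on the unfavourable
    side; what remains is a polynomial in e whose coefficients cancel up to
    e^2 and whose e^3 term dominates on the unit interval. *)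
Lemma lower_bound_expansion l e : 0 < l -> e * l ^+ 2 = 1 -> e <= 1 ->
  e / 8 - 11 * e ^+ 2 / 128 - e ^+ 3 <=
  1 - Num.sqrt (1 + 4 * l ^+ 2) / (l + Num.sqrt (1 + l ^+ 2)).
Proof.
move=> l0 el e1.
have e0 : 0 < e by rewrite -(pmulr_lgt0 _ (exprn_gt0 2 l0)) el.
have p3 : 0 < e ^+ 3 by rewrite exprn_gt0.
have p4 : 0 < e ^+ 4 by rewrite exprn_gt0.
have e43 : e ^+ 4 <= e ^+ 3 by rewrite exprS ler_piMl// ltW.
have e54 : e ^+ 5 <= e ^+ 4 by rewrite exprS ler_piMl// ltW.
have e21 : e ^+ 2 <= e by rewrite expr2 ler_piMl// ltW.
have p2 : 0 < e ^+ 2 by rewrite exprn_gt0.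
have y0 : 0 <= e / 4 by lra.
have y1 : e / 4 <= 1 by lra.
have -> : Num.sqrt (1 + 4 * l ^+ 2) = 2 * l * Num.sqrt (1 + e / 4).
  have -> : 4 * l ^+ 2 = (2 * l) ^+ 2 by ring.
  apply: sqrt1D_scale; first by rewrite mulr_gt0.
  by rewrite -[RHS]el; field.
rewrite (sqrt1D_scale l0 el).
have := sqrt1D_le y0 y1; set P := leRHS => sP.
have := sqrt1D_ge (ltW e0) e1; set Q := leLHS => sQ.
set T := 1 - e / 8 + 11 * e ^+ 2 / 128 + e ^+ 3.
have T0 : 0 <= T by rewrite /T; lra.
suff : 2 * l * Num.sqrt (1 + e / 4) / (l + l * Num.sqrt (1 + e)) <= T.
  by rewrite /T; lra.
rewrite ler_pdivrMr; last by rewrite ltr_pwDl ?mulr_ge0 ?sqrtr_ge0// ltW.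
have -> : T * (l + l * Num.sqrt (1 + e)) = l * (T * (1 + Num.sqrt (1 + e))).
  by ring.
rewrite -mulrA mulrCA ler_pM2l//.
apply: (@le_trans _ _ (2 * P)); first by rewrite ler_pM2l.
apply: (@le_trans _ _ (T * (1 + Q))); last by rewrite ler_wpM2l// lerD2l.
rewrite -subr_ge0.
have -> : T * (1 + Q) - 2 * P =
   e ^+ 3 * (2 + 15 / 256 - 1 / 512) + e ^+ 4 * (1 / 2 - 11 / 1024) - e ^+ 5 / 8.
  by rewrite /T /P /Q; field.
lra.
Qed.

Lemma coshalf_expansion l e : 0 < l -> e * l ^+ 2 = 1 -> e <= 1 ->
  1 - coshalf l <= e / 8 - 11 * e ^+ 2 / 128 + e ^+ 3.
Proof.
move=> l0 el e1.
have e0 : 0 < e by rewrite -(pmulr_lgt0 _ (exprn_gt0 2 l0)) el.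
have p2 : 0 < e ^+ 2 by rewrite exprn_gt0.
have p3 : 0 < e ^+ 3 by rewrite exprn_gt0.
have p4 : 0 < e ^+ 4 by rewrite exprn_gt0.
have p5 : 0 < e ^+ 5 by rewrite exprn_gt0.
have p6 : 0 < e ^+ 6 by rewrite exprn_gt0.
have e21 : e ^+ 2 <= e by rewrite expr2 ler_piMl// ltW.
have e32 : e ^+ 3 <= e ^+ 2 by rewrite exprS ler_piMl// ltW.
have e43 : e ^+ 4 <= e ^+ 3 by rewrite exprS ler_piMl// ltW.
have e54 : e ^+ 5 <= e ^+ 4 by rewrite exprS ler_piMl// ltW.
have e65 : e ^+ 6 <= e ^+ 5 by rewrite exprS ler_piMl// ltW.
have e76 : e ^+ 7 <= e ^+ 6 by rewrite exprS ler_piMl// ltW// exprn_gt0.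
(* The Taylor polynomial of 1 / sqrt (1 + e), truncated after a negative
   term so that it bounds [coscot l] from below. *)
set k := 1 - e / 2 + 3 * e ^+ 2 / 8 - 5 * e ^+ 3 / 16.
have k0 : 0 <= k by rewrite /k; lra.
have kc : k <= coscot l.
  rewrite ler_pdivlMr ?sqrt1D_gt0//.
  rewrite -ler_sqr ?nnegrE ?mulr_ge0 ?sqrtr_ge0 ?(ltW l0)//.
  rewrite (sqrt1D_scale l0 el) !exprMn sqr_sqrtr ?addr_ge0 ?(ltW e0)//.
  rewrite mulrCA ger_pMr ?exprn_gt0// -subr_ge0.
  have -> : 1 - k ^+ 2 * (1 + e) = e ^+ 4 * (35 / 64) - e ^+ 5 * (14 / 64)
     + e ^+ 6 * (35 / 256) - e ^+ 7 * (25 / 256) by rewrite /k; field.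
  lra.
set q := 1 - e / 8 + 11 * e ^+ 2 / 128 - e ^+ 3.
suff : q <= coshalf l by rewrite /q; lra.
(* [q] becomes negative when [e] approaches 1, where squaring is not monotone. *)
have [q0|q0] := leP q 0; first exact: le_trans q0 (sqrtr_ge0 _).
rewrite -ler_sqr ?nnegrE ?sqrtr_ge0 ?(ltW q0)// coshalf_sqr ?(ltW l0)//.
apply: (@le_trans _ _ ((1 + k) / 2)); last by lra.
rewrite -subr_ge0.
have -> : (1 + k) / 2 - q ^+ 2 = e ^+ 3 * (2 + 11 / 512 - 5 / 32)
   - e ^+ 4 * (1 / 4 + 121 / (128 * 128)) + e ^+ 5 * (11 / 64) - e ^+ 6.
  by rewrite /k /q; field.
lra.
Qed.

End Analysis.

(** * Paths in the grid *)

Definition vnorm (R : realType) (j : int * int) : R :=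
  Num.sqrt (j.1%:~R ^+ 2 + j.2%:~R ^+ 2).

Definition disp N (i k : lattice N) : int * int :=
  ((k.1 : nat)%:Z - (i.1 : nat)%:Z, (k.2 : nat)%:Z - (i.2 : nat)%:Z).

Section Lattice.
Variables (R : realType) (N L : nat).
Implicit Types x y z : lattice N.

Lemma d2E x y : d2 R x y = vnorm R (disp x y).
Proof.
rewrite /d2 /vnorm /disp /= !rmorphB /= !real_normK ?num_real//.
by congr Num.sqrt; rewrite -!pmulrn; ring.
Qed.

Lemma d2_ge0 x y : 0 <= d2 R x y. Proof. exact: sqrtr_ge0. Qed.

Lemma d2_eq0 x y : d2 R x y = 0 -> x = y.
Proof.
move=> /eqP; rewrite d2E sqrtr_eq0 => s.
have : (disp x y).1%:~R ^+ 2 + (disp x y).2%:~R ^+ 2 == 0 :> R.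
  by rewrite eq_le s addr_ge0 ?sqr_ge0.
rewrite paddr_eq0 ?sqr_ge0// !sqrf_eq0 !intr_eq0 => /andP[/eqP e1 /eqP e2].
case: x y e1 e2 {s} => [x1 x2] [y1 y2] /= e1 e2.
rewrite /disp /= in e1 e2.
by congr pair; apply: val_inj => /=; lia.
Qed.

(** Both ends lie in the grid, which is convex, so the intermediate points
    do too. *)
Lemma run_path (j : int * int) m x y :
  VL L j -> disp x y = (m%:Z * j.1, m%:Z * j.2) ->
  exists p, [/\ path (@EL N L) x p, last x p = y
              & path_cost (@d2 R N) x p = m%:R * vnorm R j].
Proof.
case: j => j1 j2 Vj; elim: m x => [|m IH] [x1 x2].
  move=> -[/= e1 e2]; exists [::]; split=> //=; last by rewrite mul0r.
  by case: y e1 e2 => [y1 y2] /= e1 e2; congr pair; apply: val_inj => /=; lia.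
case: y IH => y1 y2 IH -[/= e1 e2].
have l1 := ltn_ord x1; have l2 := ltn_ord x2.
have l3 := ltn_ord y1; have l4 := ltn_ord y2.
have b1 : 0 <= (x1 : nat)%:Z + j1 < N%:Z by nia.
have b2 : 0 <= (x2 : nat)%:Z + j2 < N%:Z by nia.
have h1 : (absz ((x1 : nat)%:Z + j1)%R < N)%N by lia.
have h2 : (absz ((x2 : nat)%:Z + j2)%R < N)%N by lia.
pose z : lattice N := (Ordinal h1, Ordinal h2).
have zE : disp (x1, x2) z = (j1, j2) by rewrite /disp /=; congr pair; lia.
case: (IH z) => [|p [ep lp cp]]; first by rewrite /disp /=; congr pair; lia.
exists (z :: p); split=> //=.
  by rewrite ep andbT /EL -/(disp (x1, x2) z) zE.
by rewrite cp d2E zE -[in RHS]addn1 natrD mulrDl mul1r addrC.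
Qed.

End Lattice.

(** * Bounds on Gamma *)

Definition is_sign (s : int) := s = 1 \/ s = -1.

Lemma int_sign_abs (v : int) :
  exists2 s, is_sign s & v = s * (absz v)%:Z.
Proof.
have [v0|v0] := leP 0 v; [exists 1|exists (-1)]; by [left|right|lia].
Qed.

(** V_L is invariant under reflection in the axes.  A zero coordinate forces
    the other one, being coprime to it, to be 1: a step of V_0. *)
Lemma VL_signed L s1 s2 (a b : nat) : is_sign s1 -> is_sign s2 ->
  coprime a b -> (a <= L)%N -> (b <= L)%N -> VL L (s1 * a%:Z, s2 * b%:Z).
Proof.
move=> S1 S2 ab aL bL.
have n1 : absz (s1 * a%:Z) = a by case: S1 => ->; lia.
have n2 : absz (s2 * b%:Z) = b by case: S2 => ->; lia.
have [a0|a0] := posnP a.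
  move: ab; rewrite a0 /coprime gcd0n => /eqP->.
  by rewrite /VL mulr0 mulr1; case: S2 => ->.
have [b0|b0] := posnP b.
  move: ab; rewrite b0 /coprime gcdn0 => /eqP->.
  by rewrite /VL mulr0 mulr1; case: S1 => ->.
rewrite /VL /= n1 n2 aL bL ab !andbT; apply/orP; right.
by apply/andP; split; lia.
Qed.

Lemma vnorm_signed (R : realType) s1 s2 (a b : nat) :
  is_sign s1 -> is_sign s2 ->
  vnorm R (s1 * a%:Z, s2 * b%:Z) = Num.sqrt (a%:R ^+ 2 + b%:R ^+ 2).
Proof.
by case=> -> [] ->; rewrite /vnorm /= ?mulN1r ?mul1r ?rmorphN ?sqrrN -?pmulrn.
Qed.

Section Bounds.
Variables (R : realType) (N L : nat).
Implicit Types x y z : lattice N.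

(** The cone decomposition of the absolute values of the displacement, carried
    back to its quadrant by reflections.  The corner [z] between the two
    straight runs lies in the bounding box of [x] and [y]. *)
Lemma short_path x y : (1 <= L)%N ->
  exists p, [/\ path (@EL N L) x p, last x p = y
    & coshalf (L%:R : R) * path_cost (@d2 R N) x p <= d2 R x y].
Proof.
move=> L1.
have [s1 S1 e1] := int_sign_abs (disp x y).1.
have [s2 S2 e2] := int_sign_abs (disp x y).2.
have [a [b [c [d [m [n [det bd eA eB mn]]]]]]] :=
  cone_decomposition (absz (disp x y).1) (absz (disp x y).2) L1.
have /and4P[aL bL cL dL] := bd.
have [cab ccd] := det1_coprime det.
rewrite eA in e1; rewrite eB in e2.
have dE : disp x y =
    (s1 * (m * a + n * c)%N%:Z, s2 * (m * b + n * d)%N%:Z).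
  by rewrite -e1 -e2; case: (disp x y).
case: x y e1 e2 dE {eA eB} => [x1 x2] [y1 y2] /= e1 e2 dE.
have l1 := ltn_ord x1; have l2 := ltn_ord x2.
have l3 := ltn_ord y1; have l4 := ltn_ord y2.
have b1 : 0 <= (x1 : nat)%:Z + s1 * (m * a)%N%:Z < N%:Z.
  by case: S1 e1 => ->; lia.
have b2 : 0 <= (x2 : nat)%:Z + s2 * (m * b)%N%:Z < N%:Z.
  by case: S2 e2 => ->; lia.
have h1 : (absz ((x1 : nat)%:Z + s1 * (m * a)%N%:Z)%R < N)%N by lia.
have h2 : (absz ((x2 : nat)%:Z + s2 * (m * b)%N%:Z)%R < N)%N by lia.
pose z : lattice N := (Ordinal h1, Ordinal h2).
have [||p [ep lp cp]] := @run_path R N L (s1 * a%:Z, s2 * b%:Z) m (x1, x2) z.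
- exact: VL_signed.
- by rewrite /disp /=; congr pair; lia.
have [||q [eq lq cq]] := @run_path R N L (s1 * c%:Z, s2 * d%:Z) n z (y1, y2).
- exact: VL_signed.
- by rewrite /disp /=; congr pair; lia.
exists (p ++ q); split; first by rewrite cat_path ep lp eq.
  by rewrite last_cat lp.
rewrite path_cost_cat lp cp cq d2E dE !vnorm_signed// !natrD !natrM.
apply: cone_ratio; rewrite ?addr_ge0 ?mulr_ge0//.
  by rewrite -!natrM det natrD.
case: mn => [mn|mn]; [left; rewrite -natrM mn// | right].
by rewrite -!natrM -natrD ler_nat.
Qed.

(** Since 1 <= L, the steps of V_0 also have first coordinate at most L. *)
Lemma linear_form_le_step (j : int * int) : (1 <= L)%N -> VL L j ->
  j.1%:~R + (Num.sqrt (1 + L%:R ^+ 2) - L%:R) * j.2%:~R <= vnorm R j.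
Proof.
move=> L1 Vj; apply: linear_form_le_norm => //.
  have -> : L%:R = L%:Z%:~R :> R by rewrite -pmulrn.
  rewrite ler_int; case/orP: Vj; last by case/and5P; lia.
  by rewrite !inE => /or4P[]/eqP-> /=; lia.
have [j0|j0] := leP j.2 0; [left | right].
  by rewrite -[0]/(0%:~R) ler_int.
by rewrite -[1]/(1%:~R) ler_int; lia.
Qed.

Lemma graph_dist_lower x y : (1 <= L)%N ->
  (disp x y).1%:~R + (Num.sqrt (1 + L%:R ^+ 2) - L%:R) * (disp x y).2%:~R
  <= graph_dist (@EL N L) (@d2 R N) x y.
Proof.
move=> L1; have [p [ep lp ->]] :=
  graph_dist_min (@d2_ge0 R N) (GL_connected L x y).
set s := _ - L%:R.
pose phi (i : lattice N) : R := (i.1 : nat)%:R + s * (i.2 : nat)%:R.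
have phiE u v : phi v - phi u = (disp u v).1%:~R + s * (disp u v).2%:~R.
  by rewrite /phi /disp /= !rmorphB /= -!pmulrn; ring.
rewrite -phiE -[in phi y]lp; apply: path_cost_ge_potential ep => u v uv.
by rewrite phiE d2E; apply: linear_form_le_step.
Qed.

Hypotheses (L1 : (1 <= L)%N) (LN : (L < N - 1)%N).

Lemma card_lattice_gt1 : (1 < #|lattice N|)%N.
Proof. by rewrite card_prod card_ord; nia. Qed.

Lemma Gamma_le : GammaGL R N L <= 1 - coshalf L%:R.
Proof.
rewrite /GammaGL.
have [[x [y [xy ->]]] _] := Gamma_max (@EL N L) (@d2 R N) card_lattice_gt1.
rewrite lerD2l lerN2 ler_pdivlMr; last first.
  apply: graph_dist_gt0 xy => //; [exact: d2_ge0|exact: d2_eq0|].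
  exact: GL_connected.
have [p [ep lp]] := short_path x y L1; apply: le_trans.
rewrite ler_wpM2l ?sqrtr_ge0// -lp; apply: graph_dist_le => //.
exact: d2_ge0.
Qed.

Lemma Gamma_ge : (2 * L <= N - 1)%N ->
  1 - Num.sqrt (1 + 4 * L%:R ^+ 2) / (L%:R + Num.sqrt (1 + L%:R ^+ 2))
  <= GammaGL R N L.
Proof.
move=> L2.
have h0 : (0 < N)%N by lia.
have h1 : (1 < N)%N by lia.
have h2 : (2 * L < N)%N by lia.
pose x : lattice N := (Ordinal h0, Ordinal h0).
pose y : lattice N := (Ordinal h2, Ordinal h1).
have xy : x <> y by case=> /=; lia.
have [_ /(_ x y xy)] := Gamma_max (@EL N L) (@d2 R N) card_lattice_gt1.
apply: le_trans; rewrite lerD2l lerN2.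
have dE : disp x y = ((2 * L)%N%:Z, 1) by rewrite /disp /=; congr pair; lia.
have d2xy : d2 R x y = Num.sqrt (1 + 4 * L%:R ^+ 2).
  rewrite d2E dE /vnorm /= -pmulrn natrM; congr Num.sqrt; ring.
have := graph_dist_lower x y L1; rewrite dE /= -pmulrn natrM mulr1.
have -> : 2 * L%:R + (Num.sqrt (1 + L%:R ^+ 2) - L%:R)
   = L%:R + Num.sqrt (1 + L%:R ^+ 2) :> R by ring.
have S0 : 0 < L%:R + Num.sqrt (1 + L%:R ^+ 2) :> R.
  by rewrite ltr_wpDl ?sqrt1D_gt0.
move=> le; rewrite d2xy ler_wpM2l ?sqrtr_ge0// lef_pV2// posrE.
exact: lt_le_trans le.
Qed.

End Bounds.

(* [2 * L <= N - 1] says that the grid contains the points (0, 0) and (2L, 1).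
   Without it the lower bound and the asymptotic expansion fail, e.g. for
   N = 4 and L = 2, where Gamma is 1 - sqrt 10 / (1 + sqrt 5). *)
Theorem theorem3p4 (R : realType) :
  (exists c : nat -> R,
    [/\ forall L : nat, (1 <= L)%N -> 25%:R / 100%:R < c L < 26%:R / 100%:R,
        forall L L' : nat, (1 <= L)%N -> (L < L')%N -> c L' < c L
      & forall N L : nat, (0 < N)%N -> (1 <= L)%N -> (L < N - 1)%N ->
          GammaGL R N L <= c L * (1 - L%:R / Num.sqrt (1 + L%:R ^+ 2)) /\
          ((2 * L <= N - 1)%N ->
             1 - Num.sqrt (1 + 4%:R * L%:R ^+ 2)
                 / (L%:R + Num.sqrt (1 + L%:R ^+ 2))
             <= GammaGL R N L)]) /\
  (exists (C : R) (L0 : nat), forall N L : nat,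
     (0 < N)%N -> (1 <= L)%N -> (L < N - 1)%N -> (2 * L <= N - 1)%N ->
     (L0 <= L)%N ->
     `|GammaGL R N L - (1 / (8%:R * L%:R ^+ 2) - 11%:R / (128%:R * L%:R ^+ 4))|
       <= C / L%:R ^+ 6).
Proof.
split.
  (* (1 - h) (1 + h) = (1 - cos theta) / 2 for h = cos (theta / 2). *)
  exists (fun L => 2^-1 / (1 + coshalf L%:R)); split.
  - move=> L L1; have L1' : 1 <= L%:R :> R by rewrite ler1n.
    have h1 := coshalf_gt L1'; have h2 := @coshalf_lt1 R L%:R (ler0n _ _).
    by apply/andP; split; [rewrite ltr_pdivlMr | rewrite ltr_pdivrMr]; lra.
  - move=> L L' L1 LL'.
    have lt := @coshalf_lt R L%:R L'%:R (ler0n _ _); rewrite ltr_nat in lt.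
    have h0 : 0 <= coshalf (L%:R : R) := sqrtr_ge0 _.
    have {}lt := lt LL'; rewrite ltr_pM2l ?invr_gt0 ?ltr0n//.
    by rewrite ltf_pV2 ?posrE; lra.
  - move=> N L _ L1 LN; split; last exact: Gamma_ge.
    apply: le_trans (Gamma_le R L1 LN) _; rewrite -/(coscot L%:R).
    have h0 : 0 <= coshalf (L%:R : R) := sqrtr_ge0 _.
    have -> : 1 - coscot L%:R = 2 * (1 - coshalf L%:R ^+ 2) :> R.
      by rewrite coshalf_sqr ?ler0n//; field.
    rewrite le_eqVlt; apply/orP; left; apply/eqP; field.
    by rewrite gt_eqF//; lra.
exists 1, 1%N => N L _ L1 LN L2 _.
have l1 : 1 <= L%:R :> R by rewrite ler1n.
have l0 : 0 < L%:R :> R by lra.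
have ln0 : L%:R != 0 :> R by rewrite gt_eqF.
pose e : R := (L%:R ^+ 2)^-1.
have el : e * L%:R ^+ 2 = 1 by rewrite mulVf ?expf_neq0.
have e1 : e <= 1 by rewrite invf_le1 ?exprn_gt0// exprn_ege1.
have -> : 1 / (8 * L%:R ^+ 2) - 11 / (128 * L%:R ^+ 4) =
    e / 8 - 11 * e ^+ 2 / 128 by rewrite /e; field.
have -> : 1 / L%:R ^+ 6 = e ^+ 3 by rewrite /e; field.
have lo := le_trans (lower_bound_expansion l0 el e1) (Gamma_ge R L1 LN L2).
have up := le_trans (Gamma_le R L1 LN) (coshalf_expansion l0 el e1).
by rewrite ler_norml; apply/andP; split; lra.
Qed.
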